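(* Let $(h_k)_{k\ge0}$ be the Fibonacci sequence ($h_0=0,h_1=1,h_k=h_{k-1}+h_{k-2}$). For each even natural number $n$, let $p_n$ and $q_n$ be primes such that $\dfrac{h_n}{h_{n-1}}<\dfrac{\log q_n}{\log p_n}<\dfrac{h_{n+1}}{h_n}$, and set $\alpha_n=p_n^{h_{n+1}}/q_n^{h_n}$. Then $\log(\#\mathcal V(\alpha_n))\ll(\log h_{n+1})^2$, i.e., there is an absolute constant $C>0$ such that $\log(\#\mathcal V(\alpha_n))\le C(\log h_{n+1})^2$ for all even $n\ge 2$.
   Context: $\mathbb N_0=\{0,1,2,\dots\}$, $\mathcal N=\{(a,b)\in\mathbb N_0^2:(a,b)\neq(0,0)\}$, $\mathcal G=\{(a,b)\in\mathcal N:\gcd(a,b)=1\}$ (convention $\gcd(a,0)=a$; $a/0=\infty$ for $a\in\mathbb N$). For positive irrational $\xi$: $\mathcal U(\xi)=\{(a,b)\in\mathcal N:a>b\xi\}$, $\mathcal L(\xi)=\{(a,b)\in\mathcal N:a<b\xi\}$, $\mathcal U_1(\xi)=\{(a,b)\in\mathcal U(\xi): a/b=\min\{m/n:(m,n)\in\mathcal U(\xi),\ m\le a\}\}$, $\mathcal L_2(\xi)=\{(a,b)\in\mathcal L(\xi): a/b=\max\{m/n:(m,n)\in\mathcal L(\xi),\ n\le b\}\}$; upper (resp. lower) best approximations for $\xi$ are elements of $\mathcal G\cap\mathcal U_1(\xi)$ (resp. $\mathcal G\cap\mathcal L_2(\xi)$). For primes $p<q$, $\xi=\log q/\log p$, $(a,b)$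 an upper or lower best approximation for $\xi$ and $\alpha=p^a/q^b$: let $(a_1,b_1),\dots,(a_N,b_N)$ be the complete list of upper or lower best approximations to $\xi$ with $a_k\le a$, $b_k\le b$ (ordered by $b_k$, ties by $a_k$), and let $T_\alpha:\mathbb R^N\to\mathbb R^2$ be the linear map with matrix rows $(a_1,\dots,a_N)$ and $(b_1,\dots,b_N)$. Then $\mathcal V(\alpha)=\{\mathbf x\in\mathbb N_0^N: T_\alpha(\mathbf x)=(a,b)^T\}$ (the set of factorization vectors). (Under the hypotheses of the claim, $(h_{n+1},h_n)$ is such a best approximation and $q_n>p_n$, so $\mathcal V(\alpha_n)$ is defined.) *)

(* Defs.v *)
From mathcomp Require Import all_boot all_order all_algebra finmap.
From mathcomp Require Import all_classical all_reals all_analysis.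

Set Implicit Arguments.
Unset Strict Implicit.
Unset Printing Implicit Defensive.

Import Order.TTheory GRing.Theory Num.Theory.
Local Open Scope classical_set_scope.
Local Open Scope ring_scope.

Fixpoint fib (n : nat) : nat :=
  match n with
  | 0 => 0
  | 1 => 1
  | (m.+1 as k).+1 => fib k + fib m
  end.

Definition is_min d (T : porderType d) (A : set T) (x : T) : Prop :=
  A x /\ lbound A x.

Definition is_max d (T : porderType d) (A : set T) (x : T) : Prop :=
  A x /\ ubound A x.

Section BestApproximations.
Variable R : realType.
Implicit Types (xi : R) (x : nat * nat).

Definition Npairs : set (nat * nat) := [set x | x != (0, 0)%N].

Definition Gpairs : set (nat * nat) := [set x | Npairs x /\ gcdn x.1 x.2 = 1%N].

(* a / b with the convention a / 0 = +oo. *)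
Definition ratio x : \bar R :=
  if x.2 == 0%N then +oo%E else (x.1%:R / x.2%:R)%:E.

Definition Upairs xi : set (nat * nat) :=
  [set x | Npairs x /\ x.1%:R > x.2%:R * xi].

Definition Lpairs xi : set (nat * nat) :=
  [set x | Npairs x /\ x.1%:R < x.2%:R * xi].

Definition U1pairs xi : set (nat * nat) :=
  [set x | Upairs xi x /\
     is_min [set ratio y | y in [set y | Upairs xi y /\ (y.1 <= x.1)%N]]
            (ratio x)].

Definition L2pairs xi : set (nat * nat) :=
  [set x | Lpairs xi x /\
     is_max [set ratio y | y in [set y | Lpairs xi y /\ (y.2 <= x.2)%N]]
            (ratio x)].

Definition upper_best_approx xi : set (nat * nat) := Gpairs `&` U1pairs xi.

Definition lower_best_approx xi : set (nat * nat) := Gpairs `&` L2pairs xi.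

Definition best_approx xi : set (nat * nat) :=
  upper_best_approx xi `|` lower_best_approx xi.

(* The candidates are enumerated with the second component in the outer loop,
   so the list is ordered by second component, ties by first component. *)
Definition best_approx_list xi (a b : nat) : seq (nat * nat) :=
  [seq x <- [seq (m, n) | n <- iota 0 b.+1, m <- iota 0 a.+1]
     | `[< best_approx xi x >]].

End BestApproximations.

(* alpha = p ^ a / q ^ b is represented by the data p, q, a, b. *)
Section Factorizations.
Variables (R : realType) (p q a b : nat).

Definition xi_alpha : R := ln q%:R / ln p%:R.

Definition list_alpha : seq (nat * nat) := best_approx_list xi_alpha a b.

Definition N_alpha : nat := size list_alpha.

Definition mat_alpha : 'M[R]_(2, N_alpha) :=
  \matrix_(i < 2, k < N_alpha)
    let x := nth (0, 0)%N list_alpha k in (if i == 0 then x.1 else x.2)%:R.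

Definition T_alpha (x : 'cV[R]_N_alpha) : 'cV[R]_2 := mat_alpha *m x.

Definition V_alpha : set 'cV[nat]_N_alpha :=
  [set x | T_alpha (map_mx (fun k : nat => k%:R) x) =
           \col_(i < 2) (if i == 0 then a else b)%:R].

(* Finiteness makes the cardinal of [fset_set V_alpha] meaningful, since
   [fset_set] sends infinite sets to the empty set. *)
Lemma finite_V_alpha : finite_set V_alpha.
Proof.
pose f (y : {ffun 'I_N_alpha -> 'I_(a + b).+1}) : 'cV[nat]_N_alpha :=
  \col_k (y k : nat).
apply: (@sub_finite_set _ _ (range f)); last exact: finite_image.
move=> x /= Vx.
have le_x k : (x k 0%R <= a + b)%N.
  have := mem_nth (0, 0)%N (ltn_ord k); set z := nth _ _ _ => zin.
  have z_gt0 : (0 < z.1 + z.2)%N.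
    move: zin; rewrite mem_filter => /andP[/asboolP + _].
    by case=> -[[+ _] _]; rewrite /Npairs /=; case: (z) => -[|?] [|?].
  have bd (i : 'I_2) : ((if i == 0%R then z.1 else z.2) * x k 0%R <=
      if i == 0%R then a else b)%N.
    have := congr1 (fun M : 'cV[R]_2 => M i 0) Vx.
    rewrite !mxE (bigD1 k)//= !mxE -/z => E.
    rewrite -(ler_nat R) -E natrM lerDl sumr_ge0// => j _.
    by rewrite !mxE mulr_ge0.
  have := leq_add (bd 0) (bd 1); rewrite /= -mulnDl.
  by apply: leq_trans; rewrite leq_pmull.
exists [ffun k => inord (x k 0)] => //.
by apply/matrixP => k j; rewrite !mxE ffunE inordK ?ltnS// ord1.
Qed.

Definition card_V_alpha : nat := #|` fset_set V_alpha|%fset.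

End Factorizations.

(* Main.v *)
(* The ratios h_n / h_(n-1) and h_(n+1) / h_n enclosing xi are consecutive
   convergents of the golden ratio, so they force every best approximation in
   the box a <= h_(n+1), b <= h_n to be a pair (h_(k+1), h_k) with k <= n:
   such a pair lies in a cone spanned by two consecutive Fibonacci pairs, which
   form a basis of Z^2 by Cassini's identity.  A factorization vector thus has
   at most n + 1 coordinates, each at most h_(n+1) + h_n < h_(n+1)^2, and
   n = O(log h_(n+1)), whence the bound. *)
Require Import Defs.
From mathcomp Require Import all_boot all_order all_algebra.
From mathcomp Require Import finmap zify ring.
From mathcomp Require Import all_classical all_reals all_analysis.
Import Order.TTheory GRing.Theory Num.Theory.
Local Open Scope ring_scope.

Lemma fibSS k : fib k.+2 = (fib k.+1 + fib k)%N.
Proof. by []. Qed.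

Lemma fib_gt0 k : (0 < fib k.+1)%N.
Proof. by elim: k => // k IH; rewrite fibSS; lia. Qed.

Local Arguments fib : simpl never.

Lemma Npairs_fib k : Npairs (fib k.+1, fib k).
Proof. by rewrite /Npairs /= xpair_eqE negb_and -!lt0n fib_gt0. Qed.

Lemma fib_double_lt m : (0 < m)%N -> (fib m.*2 < fib m.*2.+1)%N.
Proof.
by case: m => // m _; rewrite doubleS (fibSS m.*2.+1) -addn1 leq_add2l fib_gt0.
Qed.

Lemma fib_cassini k :
  (fib k.+1)%:Z ^+ 2 - (fib k)%:Z * (fib k.+2)%:Z = (-1) ^+ k.
Proof.
elim: k => // k IH.
rewrite [RHS]exprS -IH (fibSS k.+1) (fibSS k) !PoszD; ring.
Qed.

(** Two Fibonacci steps at least double the value; this is the source of n = O(log h_(n+1)). *)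
Lemma leq_exp2_fib m : (2 ^ m <= fib m.*2.+1)%N.
Proof.
elim: m => // m IH; rewrite doubleS expnS 2!fibSS.
by have := fib_gt0 m.*2; lia.
Qed.

(** By Cramer's rule and Cassini, the two signed quantities are the coordinates s and t of (a, b) in
    the basis (h_(k+1), h_k), (h_(k+2), h_(k+1)). If t >= 1, then s >= 1 forces both a >= h_(k+3)
    and b >= h_(k+2). So t = 0, and coprimality gives s = 1. *)
Lemma fib_cone k (a b : nat) : coprime a b ->
  0 < (-1) ^+ k * (a%:Z * (fib k.+1)%:Z - b%:Z * (fib k.+2)%:Z) ->
  0 <= (-1) ^+ k * (b%:Z * (fib k.+1)%:Z - a%:Z * (fib k)%:Z) ->
  (a < fib k.+3)%N || (b < fib k.+2)%N ->
  (a, b) = (fib k.+1, fib k).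
Proof.
set s := (X in 0 < X); set t := (X in 0 <= X) => cab s_gt0 t_ge0 small.
have e2 : (-1) ^+ k * (-1) ^+ k = 1%R :> int by rewrite -expr2 sqrr_sign.
have aE : a%:Z = s * (fib k.+1)%:Z + t * (fib k.+2)%:Z.
  rewrite -[LHS]mul1r -e2 -{2}fib_cassini /s /t; ring.
have bE : b%:Z = s * (fib k)%:Z + t * (fib k.+1)%:Z.
  rewrite -[LHS]mul1r -e2 -{2}fib_cassini /s /t; ring.
case: s t s_gt0 t_ge0 aE bE => // s [t|//] s_gt0 _ aE bE.
have {}aE : a = (s * fib k.+1 + t * fib k.+2)%N by lia.
have {}bE : b = (s * fib k + t * fib k.+1)%N by lia.
case: t aE bE => [|t] aE bE; last first.
  have [H1 H2] : ((fib k.+3 <= a) /\ (fib k.+2 <= b))%N.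
    rewrite aE bE (fibSS k.+1) (fibSS k); split; nia.
  by move: small; rewrite !ltnNge H1 H2.
have s1 : s = 1%N.
  apply/eqP; rewrite -dvdn1 -(eqP cab) dvdn_gcd aE bE.
  by rewrite !mul0n !addn0 !dvdn_mulr.
by rewrite aE bE s1 !mul0n !addn0 !mul1n.
Qed.

Lemma step_bracket (f : nat -> nat) m x : (f 0 <= x)%N -> (x < f m)%N ->
  exists2 j, (j < m)%N & (f j <= x < f j.+1)%N.
Proof.
move=> f0; elim: m => [|m IH] xf; first by lia.
have [/IH[j jm fj]|fm] := ltnP x (f m); first by exists j => //; lia.
by exists m => //; rewrite fm.
Qed.

Section BestApproximations.
Context {R : realType}.
Implicit Types (xi : R) (x y : nat * nat).

Lemma ratio_le_cross x y :
  (Defs.ratio R x <= Defs.ratio R y)%E -> (x.1 * y.2 <= y.1 * x.2)%N.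
Proof.
rewrite /Defs.ratio; case: eqP => [-> |/eqP x2]; case: eqP => [-> |/eqP y2];
  rewrite ?muln0 //.
by rewrite lee_fin ler_pdivrMr ?ltr0n ?lt0n// mulrAC ler_pdivlMr ?ltr0n ?lt0n//
  -!natrM ler_nat.
Qed.

Lemma best_approx_coprime xi x : best_approx xi x -> coprime x.1 x.2.
Proof. by case=> -[[_ g] _]; apply/eqP. Qed.

(* The sequence (-1)^k (h_(k+1) - h_k xi) satisfies e_k = e_(k+1) + e_(k+2), so
   its positivity propagates downwards. *)
Lemma fib_alternate xi n k : (k <= n.+1)%N ->
  0 < (-1) ^+ n * ((fib n.+1)%:R - (fib n)%:R * xi) ->
  0 < (-1) ^+ n.+1 * ((fib n.+2)%:R - (fib n.+1)%:R * xi) ->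
  0 < (-1) ^+ k * ((fib k.+1)%:R - (fib k)%:R * xi).
Proof.
elim: n => [|n IH] kn e0 e1.
  by case: k kn => [|[|]].
case: (ltngtP k n.+2) => [kn'|kn'|-> //]; last by lia.
apply: IH => //.
suff -> : (-1) ^+ n * ((fib n.+1)%:R - (fib n)%:R * xi) =
  (-1) ^+ n.+1 * ((fib n.+2)%:R - (fib n.+1)%:R * xi) +
  (-1) ^+ n.+2 * ((fib n.+3)%:R - (fib n.+2)%:R * xi) by exact: addr_gt0.
rewrite !exprS (fibSS n.+1) (fibSS n) !natrD; ring.
Qed.

(** Both products are compared with [x.2 * y.2 * xi]. The cross-multiplied form also covers
    [x.2 = 0], where the ratio is infinite. *)
Lemma upper_lower_cross xi x y :
  x.2%:R * xi < x.1%:R -> y.1%:R < y.2%:R * xi -> (0 < y.2)%N ->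
  (x.2 * y.1 < x.1 * y.2)%N.
Proof.
move=> ux ly y2; have [x2|x2] := posnP x.2.
  by move: ux; rewrite x2 mul0r ltr0n mul0n muln_gt0 y2 andbT.
rewrite -(ltr_nat R) !natrM.
apply: (@lt_trans _ _ (x.2%:R * (y.2%:R * xi))).
  by rewrite ltr_pM2l// ltr0n.
by rewrite mulrCA mulrC ltr_pM2r// ltr0n.
Qed.

Section Enclosed.
Variables (xi : R) (m : nat).
Hypothesis m_gt0 : (0 < m)%N.
Hypothesis fib_alt : forall k, (k <= m.*2)%N ->
  0 < (-1) ^+ k * ((fib k.+1)%:R - (fib k)%:R * xi).

Lemma fib_upper k : ~~ odd k -> (k <= m.*2)%N ->
  (fib k)%:R * xi < (fib k.+1)%:R.
Proof.
by move=> ek /fib_alt; rewrite -signr_odd (negbTE ek) mul1r subr_gt0.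
Qed.

Lemma fib_lower k : odd k -> (k <= m.*2)%N ->
  (fib k.+1)%:R < (fib k)%:R * xi.
Proof.
by move=> ek /fib_alt; rewrite -signr_odd ek mulN1r oppr_gt0 subr_lt0.
Qed.

(** Bracketing [x.1] between h_(2j+1) and h_(2j+3) selects the cone of index k = 2j. Lying above the
    lower pair of index 2j+1 gives s > 0, and minimality against the upper pair of index 2j gives t
    >= 0. *)
Lemma upper_best_approx_fib x : upper_best_approx xi x ->
  (x.1 <= fib m.*2.+1)%N -> (x.2 <= fib m.*2)%N ->
  exists2 k, (k <= m.*2)%N & x = (fib k.+1, fib k).
Proof.
move=> ux xa xb; have cx := best_approx_coprime xi x (or_introl ux).
case: ux => _ [[Nx Ux] [_ mx]].
(* The lower pair (h_2, h_1) = (1, 1) yields [x.2 < x.1]; the bracketing starts at h_1 = 1. *)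
have x1_gt0 : (0 < x.1)%N.
  have := upper_lower_cross xi x (fib 2, fib 1) Ux.
  by rewrite fib_lower// ?double_gt0// => /(_ isT isT); lia.
have le_fib k : ~~ odd k -> (k <= m.*2)%N -> (fib k.+1 <= x.1)%N ->
    (x.1 * fib k <= fib k.+1 * x.2)%N.
  move=> ek km kx; apply: (ratio_le_cross x (fib k.+1, fib k)).
  apply: mx; exists (fib k.+1, fib k) => //; split=> //; split.
    exact: Npairs_fib.
  exact: fib_upper.
(* The corner of the box escapes the bracketing: there minimality against (h_(2m+1), h_(2m)) forces
   [x.2] to be h_(2m). *)
have [xm|xm] := ltnP x.1 (fib m.*2.+1); last first.
  exists m.*2 => //.
  have x1E : x.1 = fib m.*2.+1 by lia.
  have := le_fib m.*2; rewrite odd_double leqnn x1E leqnn => /(_ isT isT isT).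
  rewrite leq_pmul2l ?fib_gt0// => xb'.
  by rewrite [x]surjective_pairing x1E; congr pair; lia.
have [j jm /andP[jx xj]] := @step_bracket (fun j => fib j.*2.+1) m x.1 x1_gt0 xm.
exists j.*2; first by lia.
rewrite [x]surjective_pairing; apply: fib_cone => //.
- rewrite -signr_odd odd_double mul1r.
  have := upper_lower_cross xi x (fib j.*2.+2, fib j.*2.+1) Ux.
  rewrite fib_gt0 fib_lower/= ?odd_double//; last by lia.
  by move=> /(_ isT isT); lia.
- rewrite -signr_odd odd_double mul1r.
  have := le_fib j.*2; rewrite odd_double => /(_ isT _ jx).
  by rewrite leq_double ltnW// => /(_ isT); lia.
- by rewrite xj.
Qed.

(** Here the maximum ranges over bounded second components, so [x.2] is bracketed and the cone has
    odd index k = 2j+1. Since h_(2m) < h_(2m+1), no boundary case arises. *)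
Lemma lower_best_approx_fib x : lower_best_approx xi x ->
  (x.1 <= fib m.*2.+1)%N -> (x.2 <= fib m.*2)%N ->
  exists2 k, (k <= m.*2)%N & x = (fib k.+1, fib k).
Proof.
move=> lx xa xb; have cx := best_approx_coprime xi x (or_intror lx).
case: lx => _ [[Nx Lx] [_ mx]].
have x2_gt0 : (0 < x.2)%N.
  by have [x2|//] := posnP x.2; move: Lx; rewrite /= x2 mul0r ltrn0.
have lt_m := fib_double_lt m m_gt0.
have [j jm /andP[jx xj]] :=
  @step_bracket (fun j => fib j.*2.+1) m x.2 x2_gt0 (leq_ltn_trans xb lt_m).
exists j.*2.+1; first by lia.
rewrite [x]surjective_pairing; apply: fib_cone => //.
- rewrite -signr_odd /= odd_double mulN1r.
  have := upper_lower_cross xi (fib j.*2.+3, fib j.*2.+2) x.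
  rewrite fib_upper/= ?odd_double//; last by lia.
  by move=> /(_ isT Lx x2_gt0); lia.
- rewrite -signr_odd /= odd_double mulN1r.
  suff : (fib j.*2.+2 * x.2 <= x.1 * fib j.*2.+1)%N by lia.
  apply: (ratio_le_cross (fib j.*2.+2, fib j.*2.+1) x).
  apply: mx; exists (fib j.*2.+2, fib j.*2.+1) => //; split=> //; split.
    exact: Npairs_fib.
  by apply: fib_lower; rewrite /= ?odd_double//; lia.
- by rewrite xj orbT.
Qed.

Lemma size_best_approx_list :
  (size (best_approx_list xi (fib m.*2.+1) (fib m.*2)) <= m.*2.+1)%N.
Proof.
rewrite -[leqRHS](size_iota 0) -(size_map (fun k => (fib k.+1, fib k))).
apply: uniq_leq_size.
  apply: filter_uniq; apply: allpairs_uniq; rewrite ?iota_uniq//.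
  by move=> [? ?] [? ?] _ _ [-> ->].
move=> x; rewrite mem_filter => /andP[/asboolP bx].
move=> /allpairsP[z [+ + xE]]; rewrite !mem_iota !add0n !ltnS !leq0n => z1 z2.
suff [k km ->] : exists2 k, (k <= m.*2)%N & x = (fib k.+1, fib k).
  by apply: map_f; rewrite mem_iota.
case: bx => [ux|lx].
  by apply: upper_best_approx_fib => //; rewrite xE.
by apply: lower_best_approx_fib => //; rewrite xE.
Qed.

End Enclosed.
End BestApproximations.

(** Column k of the matrix has a nonzero entry, and in that row the sum of nonnegative terms bounds
    [x k]. *)
Lemma V_alpha_le (R : realType) (p q a b : nat) (x : 'cV[nat]_(N_alpha R p q a b))
    (k : 'I_(N_alpha R p q a b)) : V_alpha x -> (x k ord0 <= a + b)%N.
Proof.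
move=> Vx; set z := nth (0, 0)%N (list_alpha R p q a b) k.
have entry (i : 'I_2) : ((if i == 0%R then z.1 else z.2) * x k ord0 <=
    if i == 0%R then a else b)%N.
  rewrite -(ler_nat R); have := congr1 (fun M : 'cV[R]_2 => M i ord0) Vx.
  rewrite !mxE => <-; rewrite (bigD1 k)//= !mxE natrM lerDl sumr_ge0// => j _.
  by rewrite !mxE mulr_ge0.
have : Npairs z.
  have := mem_nth (0, 0)%N (ltn_ord k); rewrite mem_filter => /andP[/asboolP + _].
  by case=> -[[]].
have := entry 0; have := entry 1; rewrite /=.
case: z {entry} => [[|z1] [|z2]] //= h1 h0 _; nia.
Qed.

Lemma card_V_alpha_le (R : realType) (p q a b : nat) :
  (card_V_alpha R p q a b <= (a + b).+1 ^ N_alpha R p q a b)%N.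
Proof.
set N := N_alpha R p q a b.
pose f (y : {ffun 'I_N -> 'I_(a + b).+1}) : 'cV[nat]_N := \col_k (y k : nat).
have -> : ((a + b).+1 ^ N)%N = size (map f (enum {ffun 'I_N -> 'I_(a + b).+1})).
  by rewrite size_map -cardE card_ffun !card_ord.
apply: uniq_leq_size; first exact: fset_uniq.
move=> x; rewrite in_fset_set; last exact: finite_V_alpha.
move=> /set_mem Vx; apply/mapP; exists [ffun k => inord (x k ord0)].
  by rewrite mem_enum.
apply/matrixP => k j.
by rewrite mxE ffunE inordK ?ltnS ?V_alpha_le// (ord1 j).
Qed.

Theorem theorem4p7 (R : realType) :
  exists C : R, 0 < C /\
    forall p q : nat -> nat,
      (forall n : nat, ~~ odd n -> (2 <= n)%N ->
         [/\ prime (p n), prime (q n),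
             (fib n)%:R / (fib n.-1)%:R < ln (q n)%:R / ln (p n)%:R :> R &
             ln (q n)%:R / ln (p n)%:R < (fib n.+1)%:R / (fib n)%:R :> R]) ->
      forall n : nat, ~~ odd n -> (2 <= n)%N ->
        ln (card_V_alpha R (p n) (q n) (fib n.+1) (fib n))%:R
          <= C * (ln (fib n.+1)%:R) ^+ 2.
Proof.
have ln2 : 0 < ln 2 :> R by rewrite ln_gt0// ltr1n.
(* With n = 2m and F = h_(n+1), the constant comes from 2(2m+1) <= 6m and m ln 2 <= ln F. *)
exists (6 / ln 2); split; first by rewrite divr_gt0.
move=> p q pq n en n2; have [_ _] := pq n en n2.
have [m nE m_gt0] : exists2 m, n = m.*2 & (0 < m)%N.
  by exists n./2; [rewrite even_halfK|lia].
rewrite -/(xi_alpha R (p n) (q n)); set xi := xi_alpha _ _ _.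
rewrite {}nE {en n2} in xi *.
have /= sz := @size_best_approx_list R xi m m_gt0.
move=> lo up.
have {}sz : (N_alpha R (p m.*2) (q m.*2) (fib m.*2.+1) (fib m.*2) <= m.*2.+1)%N.
  apply: sz => k km; case: m m_gt0 => // i _ in xi lo up km *.
  rewrite doubleS in xi lo up km *.
  (* The bounds [lo] and [up] on [xi] are the sign conditions at the indices 2m-1 and 2m, where m =
     i+1. *)
  apply: (@fib_alternate _ xi i.*2.+1) => //.
    rewrite -signr_odd /= odd_double mulN1r oppr_gt0 subr_lt0.
    by rewrite mulrC -ltr_pdivrMr// ltr0n fib_gt0.
  rewrite -signr_odd /= odd_double mul1r subr_gt0.
  by rewrite mulrC -ltr_pdivlMr// ltr0n fib_gt0.
set c := card_V_alpha _ _ _ _ _; set F := fib m.*2.+1.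
have F_ge : (2 ^ m <= F)%N by exact: leq_exp2_fib.
have F2 : (2 <= F)%N by apply: leq_trans F_ge; rewrite -{1}(expn1 2) leq_exp2l.
have lnF : m%:R * ln 2 <= ln F%:R :> R.
  rewrite mulr_natl -lnXn// -natrX ler_ln ?posrE ?ltr0n ?expn_gt0//.
    by rewrite ler_nat.
  by lia.
(* Each coordinate takes at most F + h_(2m) + 1 <= 2F <= F^2 values. *)
have c_le : (c <= F ^ (2 * m.*2.+1))%N.
  apply: (leq_trans (card_V_alpha_le _ _ _ _ _)).
  apply: (@leq_trans ((F + fib m.*2).+1 ^ m.*2.+1)).
    by rewrite leq_pexp2l.
  rewrite expnM leq_exp2r// expnS expn1.
  have : (fib m.*2 < F)%N by exact: fib_double_lt.
  nia.
(* If [c] is zero, the left-hand side is [ln 0], which is 0 by convention. *)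
have [c0|c_gt0] := posnP c.
  by rewrite c0 ln0// mulr_ge0// ?divr_ge0 ?sqr_ge0// ltW.
have lnc : ln c%:R <= (2 * m.*2.+1)%:R * ln F%:R :> R.
  rewrite mulr_natl -lnXn ?ltr0n; last by lia.
  rewrite -natrX ler_ln ?posrE ?ltr0n ?expn_gt0//; last by lia.
  by rewrite ler_nat.
apply: (le_trans lnc).
rewrite expr2 mulrA ler_wpM2r//; first by rewrite ln_ge0// ler1n; lia.
rewrite mulrAC ler_pdivlMr//.
have : (2 * m.*2.+1)%:R <= 6 * m%:R :> R by rewrite -natrM ler_nat; lia.
move=> h; apply: (@le_trans _ _ (6 * m%:R * ln 2)); first by rewrite ler_pM2r.
by rewrite -mulrA ler_pM2l.
Qed.
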